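(* Let $G$ be a graph, $k \geqslant 1$ and $r$ integers, and let $Q \subseteq V(G)$ be a $(k-1, r)$-cowitness for the pair $(V(G), G)$. If $G$ has no $r$-independent set of size $k$, then $Q$ is a $(k,r)$-witness in $G$.
   Context: Graphs are finite, simple and undirected; the length of a path is its number of edges. A set is $r$-independent if any two of its distinct vertices are at distance greater than $r$. For $X \subseteq V(G)$, $N_r(X)$ is the set of vertices at distance at most $r$ from some vertex of $X$. A short path is a path of length at most $r$. A set $Q$ captures a set $Y$ if some short path connecting two different vertices of $Y$ contains a vertex of $Q$ (endpoints included); $Q$ captures a pair $(Y,z)$ if some short path connecting some $y \in Y$ with $z$ contains a vertex of $Q$ (endpoints included). A $(k,r)$-witness is a set $Q$ such that every $X \subseteq V(G)$ with $|X| = k$ is captured by $Q$. For $A \subseteq V(G)$, a $(k,r)$-cowitness for $(A,G)$ is a set $Q \subseteq V(G)$ such that for every $X \subseteq A$ with $|X| = k$ and $A \subseteq N_r(X)$, and every $a \in A$, the pair $(X,a)$ is captured by $Q$. *)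

(* Defs.v *)
From HB Require Import structures.
From mathcomp Require Import all_boot all_order all_algebra.

Set Implicit Arguments.
Unset Strict Implicit.
Unset Printing Implicit Defensive.

Import Order.TTheory GRing.Theory Num.Theory.

Record sgraph := SGraph {
  svertex :> finType;
  sedge : rel svertex;
  sedge_sym : symmetric sedge;
  sedge_irr : irreflexive sedge }.

(* The path with vertex sequence x :: p, from x to y; its length is size p.
   The one-vertex path (x = y, p = [::]) is allowed. *)
Definition gpath (G : sgraph) (x y : G) (p : seq G) : bool :=
  [&& path (@sedge G) x p, last x p == y & uniq (x :: p)].

Definition has_gpath (G : sgraph) (x y : G) (n : nat) : bool :=
  [exists p : n.-tuple G, gpath x y p].

(* Length of a shortest path from x to y; None is the infinite distance
   between vertices of different components. Paths repeat no vertex, so only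
   lengths below #|G| have to be searched. *)
Definition dist (G : sgraph) (x y : G) : option nat :=
  let d := find (has_gpath x y) (iota 0 #|G|) in
  if d < #|G| then Some d else None.

Definition dist_le (G : sgraph) (x y : G) (r : int) : bool :=
  if dist x y is Some d then (d%:Z <= r)%R else false.

Definition short_path (G : sgraph) (r : int) (x y : G) (p : seq G) : bool :=
  gpath x y p && ((size p)%:Z <= r)%R.

Definition r_independent (G : sgraph) (r : int) (I : {set G}) : Prop :=
  forall x y : G, x \in I -> y \in I -> x != y -> ~~ dist_le x y r.

Definition nbhd (G : sgraph) (r : int) (X : {set G}) : {set G} :=
  [set v | [exists x in X, dist_le x v r]].

Definition captures (G : sgraph) (r : int) (Q Y : {set G}) : Prop :=
  exists x y : G, exists p : seq G,
    [/\ x \in Y, y \in Y, x != y, short_path r x y p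
      & exists2 q, q \in Q & q \in x :: p].

(* z may belong to Y, in which case the one-vertex path at z is admissible. *)
Definition captures_pair (G : sgraph) (r : int) (Q Y : {set G}) (z : G) : Prop :=
  exists y : G, exists p : seq G,
    [/\ y \in Y, short_path r y z p & exists2 q, q \in Q & q \in y :: p].

Definition witness (G : sgraph) (k : nat) (r : int) (Q : {set G}) : Prop :=
  forall X : {set G}, #|X| = k -> captures r Q X.

Definition cowitness (G : sgraph) (k : nat) (r : int) (A Q : {set G}) : Prop :=
  forall X : {set G}, X \subset A -> #|X| = k -> A \subset nbhd r X ->
  forall a : G, a \in A -> captures_pair r Q X a.

Lemma dist_leP (G : sgraph) (x y : G) (r : int) :
  reflect (exists p, short_path r x y p) (dist_le x y r).
Proof.
have has_size p : gpath x y p -> has_gpath x y (size p).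
  by move=> xyp; apply/existsP; exists (in_tuple p).
have size_lt p : gpath x y p -> size p < #|G|.
  by case/and3P=> _ _ /card_uniqP /= <-; exact: max_card.
rewrite /dist_le /dist; set d := find _ _.
apply: (iffP idP) => [|[p /andP[xyp ler]]].
  case: ifP => // ltd ler.
  have hd : has (has_gpath x y) (iota 0 #|G|) by rewrite has_find size_iota.
  have := nth_find 0 hd; rewrite -/d nth_iota // add0n => /existsP[p xyp].
  by exists p; rewrite /short_path xyp size_tuple.
have led : d <= size p.
  rewrite leqNgt; apply/negP => ltpd.
  have := before_find 0 ltpd.
  by rewrite nth_iota ?size_lt // add0n has_size.
rewrite (leq_ltn_trans led (size_lt _ xyp)).
by apply: le_trans ler; rewrite lez_nat.
Qed.

(* Main.v *)
Require Import Defs.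
From HB Require Import structures.
From mathcomp Require Import all_boot all_order all_algebra.

Set Implicit Arguments.
Unset Strict Implicit.
Unset Printing Implicit Defensive.

(** Let [X] be a set of [k] vertices; it is not [r]-independent, so some [x] in
    [X] is close to another vertex of [X]. If [X :\ x] [r]-dominates the graph,
    the cowitness property applied to [(X :\ x, x)] shows that [X] is captured.
    Otherwise replace [x] by a vertex [v] far from [X :\ x]: no short path joins
    [v] to [X :\ x], so if the new set is captured then so was [X], and the new
    set has fewer vertices close to another one of its vertices. *)

(** The start vertex is kept outside the sequence, so the reversed path lists [x :: p] backwards
    without its last vertex [y]. *)
Lemma gpath_rev (G : sgraph) (x y : G) (p : seq G) :
  gpath x y p -> gpath y x (rev (belast x p)).
Proof.
case/and3P=> xp /eqP <- up; apply/and3P; split.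
- by rewrite rev_path (eq_path (e' := @sedge G)) // => a b; rewrite sedge_sym.
- by case: p {xp up} => //= a p; rewrite rev_cons last_rcons.
- by rewrite -rev_rcons -lastI rev_uniq.
Qed.

Lemma dist_le_sym (G : sgraph) (r : int) (x y : G) :
  dist_le x y r = dist_le y x r.
Proof.
have imp (a b : G) : dist_le a b r -> dist_le b a r.
  case/dist_leP=> p /andP[/gpath_rev bap ler]; apply/dist_leP.
  by exists (rev (belast a p)); rewrite /short_path bap size_rev size_belast.
by apply/idP/idP; apply: imp.
Qed.

Lemma dist_le_refl (G : sgraph) (r : int) (x : G) : (0 <= r)%R -> dist_le x x r.
Proof.
by move=> r0; apply/dist_leP; exists [::]; rewrite /short_path /gpath /= eqxx.
Qed.

Lemma dist_le_ge0 (G : sgraph) (r : int) (x y : G) : dist_le x y r -> (0 <= r)%R.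
Proof. by case/dist_leP=> p /andP[_]; apply: Order.POrderTheory.le_trans. Qed.

(** The vertices that obstruct [r]-independence of [X]; their number is the induction measure. *)
Definition crowded (G : sgraph) (r : int) (X : {set G}) : {set G} :=
  [set x in X | [exists y in X, (x != y) && dist_le x y r]].

Lemma crowdedP {G : sgraph} {r : int} {X : {set G}} {x : G} :
  reflect (x \in X /\ exists2 y, y \in X & (x != y) && dist_le x y r)
          (x \in crowded r X).
Proof. by rewrite inE; apply: (iffP andP) => -[xX /exists_inP]. Qed.

Lemma crowded0_independent (G : sgraph) (r : int) (X : {set G}) :
  crowded r X = set0 -> r_independent r X.
Proof.
move=> X0 x y xX yX xy; apply/negP => xyr.
suff: x \in crowded r X by rewrite X0 inE.
by apply/crowdedP; split=> //; exists y; rewrite ?xy.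
Qed.

Section Exchange.

Variables (G : sgraph) (r : int) (X : {set G}) (x v : G).
Hypothesis vfar : v \notin nbhd r (X :\ x).

Lemma far_from_rest y : y \in X :\ x -> dist_le y v r = false.
Proof.
move=> yX; apply/negP => yv; case/negP: vfar.
by rewrite inE; apply/exists_inP; exists y.
Qed.

(** By the choice of [v], a close pair of distinct vertices cannot involve [v], so it already lies
    in [X :\ x]. *)
Lemma exchange_close_pair y z :
    y \in v |: X :\ x -> z \in v |: X :\ x -> y != z -> dist_le y z r ->
  y \in X :\ x /\ z \in X :\ x.
Proof.
case/setU1P=> [->|yX] /setU1P[->|zX] //; first by rewrite eqxx.
  by rewrite dist_le_sym far_from_rest.
by rewrite far_from_rest.
Qed.

Lemma exchange_captures (Q : {set G}) :
  captures r Q (v |: X :\ x) -> captures r Q X.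
Proof.
case=> y [z [p [yX zX yz yzp Qp]]].
have yzr : dist_le y z r by apply/dist_leP; exists p.
have [/setD1P[_ yX'] /setD1P[_ zX']] := exchange_close_pair yX zX yz yzr.
by exists y, z, p.
Qed.

(** The vertex [v] is new: in [X :\ x] it would be at distance 0 from that set. This requires
    [0 <= r], which follows from the short path that makes [x] crowded. *)
Lemma card_exchange : x \in crowded r X -> #|v |: X :\ x| = #|X|.
Proof.
case/crowdedP=> xX [y _ /andP[_ /dist_le_ge0 r0]].
rewrite cardsU1 (cardsD1 x X) xX; case: (boolP (v \in _)) => // vX.
by have := dist_le_refl v r0; rewrite far_from_rest.
Qed.

(** Close pairs of the new set are close pairs of [X] avoiding [x]; hence [v] is not crowded and [x]
    is lost. *)
Lemma crowded_exchange :
  x \in crowded r X -> crowded r (v |: X :\ x) \proper crowded r X.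
Proof.
have sub y : y \in crowded r (v |: X :\ x) -> y != x /\ y \in crowded r X.
  case/crowdedP=> yX [z zX /andP[yz yzr]].
  have [/setD1P[yx yX'] /setD1P[_ zX']] := exchange_close_pair yX zX yz yzr.
  by split=> //; apply/crowdedP; split=> //; exists z; rewrite ?yz.
move=> xX; apply/properP; split; first by apply/subsetP => y /sub[].
by exists x => //; apply/negP => /sub[]; rewrite eqxx.
Qed.

End Exchange.

Theorem mainTheorem4 (G : sgraph) (k : nat) (r : int) (Q : {set G})
  (hk : 1 <= k)
  (hQ : cowitness (k - 1) r [set: G] Q)
  (hindep : ~ exists I : {set G}, r_independent r I /\ #|I| = k) :
  witness k r Q.
Proof.
move=> X; have [n] := ubnP #|crowded r X|; elim: n X => // n IHn X ltX cardX.
have [/crowded0_independent X0|[x xC]] := set_0Vmem (crowded r X).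
  by case: hindep; exists X.
have xX : x \in X by case/crowdedP: xC.
have [dom|/subsetPn[v _ vfar]] := boolP ([set: G] \subset nbhd r (X :\ x)).
  have cardXx : #|X :\ x| = k - 1 by rewrite -cardX (cardsD1 x X) xX addKn.
  (* Removing [x] from the set forces [y != x], so the captured path joins two different vertices of
     [X]. *)
  have [y [p [/setD1P[yx yX] yxp Qp]]] :=
    hQ _ (subsetT _) cardXx dom x (in_setT x).
  by exists y, x, p.
apply: (exchange_captures vfar); apply: IHn.
  by apply: leq_trans (proper_card (crowded_exchange vfar xC)) _.
by rewrite (card_exchange vfar).
Qed.
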